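(* Let $C\subset\mathbb{R}^n$ be a nonempty open convex set, and let $f,g,\phi$ and $\Psi=f+g$ satisfy Assumptions (A), (B), (C), (D) listed in the context, with $L>0$ the constant of the $L$-smad property in (C). Let $\alpha\in(0,1)$, $\lambda>0$, $\bm{x}\in\operatorname{int}\operatorname{dom}\phi$, and let $$\bm{d}=\operatorname{argmin}_{\bm{u}:\ \bm{x}+\bm{u}\in\operatorname{cl}C}\left\{\langle\nabla f(\bm{x}),\bm{u}\rangle+g(\bm{x}+\bm{u})+\frac{1}{2\lambda}\langle\nabla^2\phi(\bm{x})\bm{u},\bm{u}\rangle\right\}.$$ Then there is some $\beta\ge0$ (which may depend on $\bm{x}$ and $\bm{d}$) such that, for every $t>0$ with $$t\le\min\left\{1,\frac{1-\alpha}{\beta\lambda L}\right\},$$ the point $\bm{x}^+=\bm{x}+t\bm{d}$ satisfies the sufficient decreasing condition $$\Psi(\bm{x}^+)\le\Psi(\bm{x})+\alpha t\left(\langle\nabla f(\bm{x}),\bm{d}\rangle+g(\bm{x}+\bm{d})-g(\bm{x})\right).$$ Consequently, for any $\eta\in(0,1)$, the backtracking line search that starts from $t=1$ and replaces $t$ by $\eta t$ as long as the sufficient decreasing condition fails satisfies this condition after finitely many steps.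
   Context: Problem: minimize $\Psi(\bm{x}):=f(\bm{x})+g(\bm{x})$ over $\bm{x}\in\operatorname{cl}C$, where $C\subset\mathbb{R}^n$ is a nonempty open convex set. Kernel generating distances: $\mathcal{G}(C)$ is the class of functions $\phi:\mathbb{R}^n\to(-\infty,+\infty]$ that are proper, lower semicontinuous and convex, with $\operatorname{dom}\phi\subset\operatorname{cl}C$, $\operatorname{dom}\partial\phi=C$, and $\phi$ is $\mathcal{C}^1$ on $\operatorname{int}\operatorname{dom}\phi=C$. $L$-smooth adaptable ($L$-smad): for $\phi\in\mathcal{G}(C)$ and $f:\mathbb{R}^n\to(-\infty,+\infty]$ proper and lower semicontinuous with $\operatorname{dom}\phi\subset\operatorname{dom}f$ and $f$ of class $\mathcal{C}^1$ on $C$, the pair $(f,\phi)$ is $L$-smad on $C$, with $L>0$, if $L\phi-f$ and $L\phi+f$ are convex on $C$. Assumption (A): (i) $\phi\in\mathcal{G}(C)$ with $\operatorname{cl}C=\operatorname{cl}\operatorname{dom}\phi$ is $\mathcal{C}^2$ on $C=\operatorname{int}\operatorname{dom}\phi$. (ii) $f:\mathbb{R}^n\to(-\infty,+\infty]$ is proper and lower semicontinuous with $\operatorname{dom}\phi\subset\operatorname{dom}f$, and is $\mathcal{C}^1$ on $C$. (iii) $g:\mathbb{R}^n\to(-\infty,+\infty]$ is proper and convex with $\operatorname{dom}g\cap C\neq\emptyset$. (iv) $\Psi^*:=\inf_{\bm{x}\in\operatorname{cl}C}\Psi(\bm{x})>-\infty$. (v) For any $\bm{x}\in\operatorname{int}\operatorname{dom}\phi$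 and $\lambda>0$, the function $\bm{u}\mapsto\lambda g(\bm{u})+\frac12\langle\nabla^2\phi(\bm{x})(\bm{u}-\bm{x}),\bm{u}-\bm{x}\rangle$ is supercoercive: its value divided by $\|\bm{u}\|$ tends to $\infty$ as $\|\bm{u}\|\to\infty$. Assumption (B): for any $\bm{x}\in C$ and $\lambda>0$, $\tilde{\mathcal{T}}_\lambda(\bm{x})\subset C$, where $\tilde{\mathcal{T}}_\lambda(\bm{x}):=\operatorname{argmin}_{\bm{u}\in\operatorname{cl}C}\{\langle\nabla f(\bm{x}),\bm{u}-\bm{x}\rangle+g(\bm{u})+\frac{1}{2\lambda}\langle\nabla^2\phi(\bm{x})(\bm{u}-\bm{x}),\bm{u}-\bm{x}\rangle\}$. Assumption (C): the pair $(f,\phi)$ is $L$-smad on $C$. Assumption (D): $\phi$ is $\sigma$-strongly convex on $C$ for some $\sigma>0$. Convention: if $\beta=0$, then $\frac{1-\alpha}{\beta\lambda L}$ is read as $+\infty$. *)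

(* Defs.v *)
From HB Require Import structures.
From mathcomp Require Import all_boot all_order all_algebra.
From mathcomp Require Import all_classical all_reals all_analysis.

Set Implicit Arguments.
Unset Strict Implicit.
Unset Printing Implicit Defensive.

Import Order.TTheory GRing.Theory Num.Theory.
Import numFieldNormedType.Exports.

Local Open Scope classical_set_scope.
Local Open Scope ring_scope.

(* Vectors of R^n are row vectors. The norm that the library puts on 'rV[R]_n
   is the sup norm: it gives the usual topology and differentiability, but the
   Euclidean norm has to be written [enorm]. *)
Section Euclidean.
Context {R : realType} {n : nat}.
Implicit Types (u v x : 'rV[R]_n) (h : 'rV[R]_n -> R) (C : set 'rV[R]_n).

Definition dot u v : R := \sum_(i < n) u 0 i * v 0 i.

Definition enorm u : R := Num.sqrt (dot u u).

Definition grad h x : 'rV[R]_n := \row_(i < n) 'D_(delta_mx 0 i) h x.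

(* Entry (i, j) is the i-th partial derivative of the j-th component of
   [grad h]. *)
Definition hess h x : 'M[R]_n := 'J (grad h) x.

(* Matrices act on row vectors from the right. *)
Definition hess_form h x u : R := dot (u *m hess h x) u.

(* [C1_on] and [C2_on] are meant for open sets. *)
Definition C1_on C h : Prop :=
  forall x, C x -> differentiable h x /\ {for x, continuous (grad h)}.

Definition C2_on C h : Prop :=
  C1_on C h /\
  forall x, C x -> differentiable (grad h) x /\ {for x, continuous (hess h)}.

Definition strongly_convex_on (sigma : R) C h : Prop :=
  forall x y (t : R), C x -> C y -> 0 <= t <= 1 ->
    h (t *: x + (1 - t) *: y) <=
    t * h x + (1 - t) * h y - sigma / 2 * t * (1 - t) * enorm (x - y) ^+ 2.

End Euclidean.

(* Functions R^n -> (-oo, +oo] are total functions to \bar R, -oo being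
   excluded by [proper_fun]. Where such a function is finite, its real-valued
   version is [fine \o f]. *)
Section ExtendedValued.
Context {R : realType} {n : nat}.
Implicit Types (x u v d : 'rV[R]_n) (f g phi F : 'rV[R]_n -> \bar R)
  (C S : set 'rV[R]_n) (L lambda alpha t : R).
Local Open Scope ereal_scope.

Definition edom f : set 'rV[R]_n := [set x | f x < +oo].

Definition proper_fun f : Prop :=
  (forall x, -oo < f x) /\ (exists x, f x < +oo).

Definition convex_efun f : Prop :=
  forall x y t, (0 <= t <= 1)%R ->
    f (t *: x + (1 - t) *: y)%R <= t%:E * f x + (1 - t)%:E * f y.

Definition subdiff f x : set 'rV[R]_n :=
  [set v | f x \is a fin_num /\
           forall y, f x + (dot v (y - x)%R)%:E <= f y].

Definition argmin S F : set 'rV[R]_n :=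
  [set u | S u /\ forall v, S v -> F u <= F v].

Definition supercoercive F : Prop :=
  forall A : R, exists r : R, forall u,
    (r < enorm u)%R -> A%:E < F u / (enorm u)%:E.

Record kernel_generating_distance C phi : Prop := {
  kgd_proper : proper_fun phi;
  kgd_lsc : lower_semicontinuous phi;
  kgd_convex : convex_efun phi;
  kgd_dom : edom phi `<=` closure C;
  kgd_dom_subdiff : [set x | subdiff phi x !=set0] = C;
  kgd_int_dom : interior (edom phi) = C;
  kgd_C1 : C1_on C (fine \o phi) }.

Record smooth_adaptable L C f phi : Prop := {
  smad_L_gt0 : (0 < L)%R;
  smad_kernel : kernel_generating_distance C phi;
  smad_proper : proper_fun f;
  smad_lsc : lower_semicontinuous f;
  smad_dom : edom phi `<=` edom f;
  smad_C1 : C1_on C (fine \o f);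
  smad_convexB : convex_function C (fun x => L * fine (phi x) - fine (f x))%R;
  smad_convexD : convex_function C (fun x => L * fine (phi x) + fine (f x))%R }.

Record problem_assumptions C f g phi : Prop := {
  pa_kernel : kernel_generating_distance C phi;
  pa_closure : closure C = closure (edom phi);
  pa_phi_C2 : C2_on C (fine \o phi);
  pa_f_proper : proper_fun f;
  pa_f_lsc : lower_semicontinuous f;
  pa_f_dom : edom phi `<=` edom f;
  pa_f_C1 : C1_on C (fine \o f);
  pa_g_proper : proper_fun g;
  pa_g_convex : convex_efun g;
  pa_g_dom : edom g `&` C !=set0;
  pa_inf : -oo < ereal_inf [set f x + g x | x in closure C];
  pa_supercoercive : forall x lambda,
    interior (edom phi) x -> (0 < lambda)%R ->
    supercoercive (fun u =>
      lambda%:E * g u + (2^-1 * hess_form (fine \o phi) x (u - x))%:E) }.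

Definition subproblem_argmin C f g phi lambda x : set 'rV[R]_n :=
  argmin (closure C) (fun u =>
    (dot (grad (fine \o f) x) (u - x)%R)%:E + g u
    + ((2 * lambda)^-1 * hess_form (fine \o phi) x (u - x))%:E).

Definition subproblem_interior C f g phi : Prop :=
  forall x lambda, C x -> (0 < lambda)%R ->
    subproblem_argmin C f g phi lambda x `<=` C.

Definition search_direction C f g phi lambda x : set 'rV[R]_n :=
  argmin [set u | closure C (x + u)%R] (fun u =>
    (dot (grad (fine \o f) x) u)%:E + g (x + u)%R
    + ((2 * lambda)^-1 * hess_form (fine \o phi) x u)%:E).

(* The sums are the library's dual ones, for which +oo - oo = +oo: this matters
   only when [g x = +oo], where both f x + g x and the right-hand side are then
   +oo. *)
Definition sufficient_decrease f g alpha x d t : Prop :=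
  ((f (x + t *: d)%R + g (x + t *: d)%R) <=
   (f x + g x) + (alpha * t)%:E *
     ((dot (grad (fine \o f) x) d)%:E + g (x + d)%R - g x))%dE.

(* The inverse on \bar R satisfies 0^-1 = +oo, so that the quotient is +oo when
   beta = 0 (for alpha < 1). *)
Definition step_bound alpha beta lambda L : \bar R :=
  mine 1 ((1 - alpha)%:E / (beta * lambda * L)%:E).

End ExtendedValued.

(* Main.v *)
Require Import Defs.
From HB Require Import structures.
From mathcomp Require Import all_boot all_order all_algebra.
From mathcomp Require Import all_classical all_reals all_analysis.
From mathcomp Require Import ring lra.

Import Order.TTheory GRing.Theory Num.Theory.
Import numFieldNormedType.Exports.

Local Open Scope classical_set_scope.
Local Open Scope ring_scope.

(** Write Q for the Hessian form of phi at x along d; strong convexity gives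
    Q > 0 unless d = 0. Comparing the objective of the subproblem at d and at 0
    gives <grad f x, d> + g (x + d) - g x <= - Q / (2 lambda). Convexity of
    L phi - f bounds the increase of f beyond its linear part by L times the
    Bregman distance of phi, and the latter is at most b Q t^2 on (0, 1]: near 0
    because grad phi is differentiable at x, away from 0 because phi is bounded
    above on the segment by convexity. Hence beta = 2 b works; no bound on the
    Hessian along the segment is needed. *)

Section Euclidean.
Set Implicit Arguments.
Unset Strict Implicit.
Context {R : realType} {n : nat}.
Implicit Types (u v x y d : 'rV[R]_n) (h : 'rV[R]_n -> R) (C : set 'rV[R]_n).

(** * Euclidean inner product and segments *)

Lemma dotZl (a : R) u v : dot (a *: u) v = a * dot u v.
Proof. by rewrite mulr_sumr; apply: eq_bigr => i _; rewrite mxE mulrA. Qed.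

Lemma dotZr (a : R) u v : dot u (a *: v) = a * dot u v.
Proof. by rewrite mulr_sumr; apply: eq_bigr => i _; rewrite mxE mulrCA. Qed.

Lemma dot0r u : dot u 0 = 0.
Proof. by rewrite -(scale0r 0) dotZr mul0r. Qed.

Lemma dotBl u v w : dot (u - v) w = dot u w - dot v w.
Proof. by rewrite -sumrB; apply: eq_bigr => i _; rewrite !mxE mulrBl. Qed.

Lemma dot_ge0 u : 0 <= dot u u.
Proof. by apply: sumr_ge0 => i _; rewrite -expr2 sqr_ge0. Qed.

Lemma sqr_enorm u : enorm u ^+ 2 = dot u u.
Proof. by rewrite sqr_sqrtr // dot_ge0. Qed.

Lemma sqr_enorm_gt0 u : u != 0 -> 0 < enorm u ^+ 2.
Proof.
rewrite sqr_enorm lt0r dot_ge0 andbT; apply: contraNneq.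
move=> /psumr_eq0P u0; apply/eqP/rowP => i; rewrite mxE.
have /eqP := u0 (fun i _ => sqr_ge0 (u 0 i)) i isT.
by rewrite mulf_eq0 orbb => /eqP.
Qed.

Lemma segment_from x d (t : R) :
  t *: (x + d) + (1 - t) *: x = x + t *: d.
Proof. by rewrite scalerDr scalerBl scale1r addrC -addrA [- _ + _]addKr. Qed.

Lemma convex_set_segment C x y t : convex_set C -> C x -> C y -> 0 <= t <= 1 ->
  C (t *: x + (1 - t) *: y).
Proof.
move=> cC Cx Cy /andP[t0 t1].
by have := cC x y (Itv01 t0 t1); rewrite !inE; exact.
Qed.

(** Lets one tangent inequality serve both [phi] and [L * phi - f]. *)
Lemma convex_strongly_convex_on0 C h :
  convex_function C h -> strongly_convex_on 0 C h.
Proof.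
move=> ch x y t Cx Cy /andP[t0 t1].
have := ch (Itv01 t0 t1) x y; rewrite !inE => /(_ Cx Cy).
by rewrite !mul0r subr0.
Qed.

(** * First-order behaviour along a line *)

Lemma diff_grad h x v : differentiable h x -> 'd h x v = dot (grad h x) v.
Proof.
move=> dh; rewrite [in LHS](row_sum_delta v) linear_sum; apply: eq_bigr => i _.
by rewrite linearZ /= mxE deriveE // mulrC.
Qed.

Lemma is_derive_line h x d (s : R) : differentiable h (x + s *: d) ->
  is_derive s 1 (fun s => h (x + s *: d)) (dot (grad h (x + s *: d)) d).
Proof.
move=> dh; set k := fun s : R => h (x + s *: d).
have E : (fun a : R => a^-1 *: ((k \o shift s) (a *: 1) - k s)) =
    fun a => a^-1 *: ((h \o shift (x + s *: d)) (a *: d) - h (x + s *: d)).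
  apply/funext => a; congr (_ *: (h _ - _)) => /=.
  by rewrite -[a *: 1]/(a * 1) mulr1 scalerDl addrCA.
apply: DeriveDef.
  by rewrite /derivable E; exact: (diff_derivable dh).
by rewrite /derive E -diff_grad // -deriveE.
Qed.

Lemma grad_line_cvg h x d : differentiable h x ->
  t^-1 * (h (x + t *: d) - h x) @[t --> 0^'+] --> dot (grad h x) d.
Proof.
move=> dh; apply: cvg_dnbhs_at_right.
rewrite -diff_grad // -deriveE //.
have -> : (fun t : R => t^-1 * (h (x + t *: d) - h x)) =
    fun t : R => t^-1 *: ((h \o shift x) (t *: d) - h x).
  by apply/funext => t; rewrite /= [t *: d + x]addrC.
exact: (diff_derivable dh).
Qed.

(** Divide the strong convexity inequality at [x + t *: (y - x)] by [t] and let [t] tend to 0 from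
    the right. *)
Lemma strongly_convex_on_tangent sigma C h x y :
  strongly_convex_on sigma C h -> C x -> C y -> differentiable h x ->
  h x + dot (grad h x) (y - x) + sigma / 2 * enorm (y - x) ^+ 2 <= h y.
Proof.
move=> sc Cx Cy dh; set q := sigma / 2 * _.
have lim_l := grad_line_cvg (d := y - x) dh.
have lim_r : h y - h x - q * (1 - t) @[t --> 0^'+] --> h y - h x - q * (1 - 0).
  apply: cvg_at_right_filter; apply: cvgB; first exact: cvg_cst.
  by apply: cvgMr; apply: cvgB; [exact: cvg_cst | exact: cvg_id].
suff : dot (grad h x) (y - x) <= h y - h x - q * (1 - 0) by lra.
apply: (ler_cvg_to lim_l lim_r); near=> t.
have t0 : 0 < t by near: t; exact: nbhs_right_gt.
have t1 : t < 1 by near: t; exact: nbhs_right_lt.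
have := sc y x t Cy Cx _; rewrite (ltW t0) (ltW t1) => /(_ isT).
rewrite -[in t *: y](subrKC x y) segment_from.
rewrite ler_pdivrMl // /q; lra.
Unshelve. all: by end_near. Qed.

(** * Second-order estimates and the Bregman distance *)

Lemma dot_grad_line_cvg h x d : differentiable (grad h) x ->
  t^-1 * (dot (grad h (x + t *: d)) d - dot (grad h x) d) @[t --> 0^'+]
    --> hess_form h x d.
Proof.
move=> dg; apply: cvg_dnbhs_at_right.
have dd : derivable (grad h) x d by exact: diff_derivable.
have -> : (fun t : R => t^-1 * (dot (grad h (x + t *: d)) d - dot (grad h x) d))
  = fun t : R => \sum_(i < n)
      (t^-1 *: ((grad h \o shift x) (t *: d) - grad h x)) 0 i * d 0 i.
  apply/funext => t /=; rewrite -[RHS]/(dot _ d) dotZl dotBl.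
  by rewrite [t *: d + x]addrC.
rewrite /hess_form /hess -deriveEjacobian //.
apply: cvg_big => [|i _]; first exact: add_continuous.
apply: cvgMl.
by apply: (cvg_comp _ _ dd (@coord_continuous _ _ _ _ _ _)).
Qed.

Lemma open_near_line C x d : open C -> C x ->
  \forall t \near (0 : R), C (x + t *: d).
Proof.
move=> oC Cx.
have : (fun t : R => x + t *: d) t @[t --> 0] --> x + 0 *: d.
  by apply: cvgD; [exact: cvg_cst | exact: scalel_continuous].
by apply; rewrite scale0r addr0; exact: open_nbhs_nbhs.
Qed.

(** Adding the tangent inequalities at [x] and at [x + t *: d] gives strong monotonicity of the
    gradient; divide by [t ^+ 2] and let [t] tend to 0. *)
Lemma strongly_convex_on_hess sigma C h x d :
  strongly_convex_on sigma C h -> open C -> C x -> C1_on C h ->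
  differentiable (grad h) x -> sigma * enorm d ^+ 2 <= hess_form h x d.
Proof.
move=> sc oC Cx C1 dg.
have near_C := open_near_line d oC Cx.
apply: (ler_cvg_to (cvg_cst (sigma * enorm d ^+ 2))
  (dot_grad_line_cvg (d := d) dg)).
near=> t.
have t0 : 0 < t by near: t; exact: nbhs_right_gt.
have Ct : C (x + t *: d) by near: t; exact: cvg_within near_C.
have := strongly_convex_on_tangent sc Cx Ct (C1 _ Cx).1.
have := strongly_convex_on_tangent sc Ct Cx (C1 _ Ct).1.
have -> : x - (x + t *: d) = - (t *: d) by rewrite opprD addrA subrr add0r.
have -> : x + t *: d - x = t *: d by rewrite addrC addKr.
rewrite -scalerN !dotZr !sqr_enorm !dotZl !dotZr.
rewrite [dot _ (- d)](_ : _ = - dot (grad h (x + t *: d)) d); last first.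
  by rewrite -scaleN1r dotZr mulN1r.
rewrite [dot (- d) _](_ : _ = dot d d); last first.
  by rewrite -scaleN1r dotZr dotZl; ring.
by rewrite ler_pdivlMl // => H1 H2; rewrite -(ler_pM2l t0); lra.
Unshelve. all: by end_near. Qed.

(** The mean value theorem gives slope [p] at some [s] in (0, t), and differentiability of the
    gradient at [x] alone bounds [p - q] by [(w + e) * s]. Taylor's factor 1/2 is given up. *)
Lemma second_order_upper_bound C h x d e : open C -> C x -> C1_on C h ->
  differentiable (grad h) x -> 0 <= hess_form h x d -> 0 < e ->
  \forall t \near 0^'+, h (x + t *: d) <=
    h x + t * dot (grad h x) d + (hess_form h x d + e) * t ^+ 2.
Proof.
move=> oC Cx C1 dg w0 e0.
have /cvgrPdist_lt/(_ _ e0) near_q := dot_grad_line_cvg (d := d) dg.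
have near_C := open_near_line d oC Cx.
have [a /= a0 Ha] := near_q; have [b /= b0 Hb] := near_C.
near=> t.
have t0 : 0 < t by near: t; exact: nbhs_right_gt.
have ta : t < a by near: t; exact: nbhs_right_lt.
have tb : t < b by near: t; exact: nbhs_right_lt.
have CS s : 0 <= s <= t -> C (x + s *: d).
  rewrite le_eqVlt => /andP[/predU1P[<- _|s0 st]].
    by rewrite scale0r addr0.
  by apply: Hb; rewrite /= sub0r normrN gtr0_norm // (le_lt_trans st).
have dS s : 0 <= s <= t ->
    is_derive s 1 (fun s => h (x + s *: d)) (dot (grad h (x + s *: d)) d).
  by move=> /CS /C1[dh _]; exact: is_derive_line.
have [||s] := @MVT _ (fun s => h (x + s *: d))
  (fun s => dot (grad h (x + s *: d)) d) 0 t t0.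
- by move=> s; rewrite in_itv /= => /andP[s0 st]; apply: dS; rewrite !ltW.
- by apply: derivable_within_continuous => s; rewrite in_itv /= => /dS[].
rewrite in_itv /= scale0r addr0 subr0 => /andP[s0 st] E.
have : `|hess_form h x d
        - s^-1 * (dot (grad h (x + s *: d)) d - dot (grad h x) d)| < e.
  by apply: Ha => //=; rewrite sub0r normrN gtr0_norm // (lt_trans st).
rewrite ltr_norml => /andP[+ _].
set p := dot _ _ in E *; set q := dot (grad h x) d.
set w := hess_form h x d in w0 * => Hp.
have {}Hp : p - q < (w + e) * s.
  by rewrite -ltr_pdivrMr // mulrC; lra.
have {}Hp : p <= q + (w + e) * t.
  by have := ler_wpM2l (addr_ge0 w0 (ltW e0)) (ltW st); lra.
by have := ler_wpM2r (ltW t0) Hp; lra.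
Unshelve. all: by end_near. Qed.

Lemma bregman_quadratic_bound sigma C h x d : 0 < sigma ->
  strongly_convex_on sigma C h -> open C -> C x -> C (x + d) -> C1_on C h ->
  differentiable (grad h) x ->
  exists2 b, 0 <= b & forall t, 0 < t <= 1 ->
    h (x + t *: d) - h x - t * dot (grad h x) d <= b * hess_form h x d * t ^+ 2.
Proof.
move=> s0 sc oC Cx Cxd C1 dg.
(* The constant below divides by [w], which vanishes for [d = 0]; there both sides are 0. *)
have [->|d0] := eqVneq d 0.
  by exists 0 => // t _; rewrite dot0r scaler0 addr0 subrr !mul0r mulr0 subrr.
set w := hess_form h x d; set q := dot (grad h x) d.
have w0 : 0 < w.
  apply: (lt_le_trans _ (strongly_convex_on_hess d sc oC Cx C1 dg)).
  by rewrite mulr_gt0 // sqr_enorm_gt0.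
have [e /= e0 He] := second_order_upper_bound oC Cx C1 dg (ltW w0) w0.
pose B := `|h (x + d) - h x - q|; have B0 : 0 <= B := normr_ge0 _.
(* The 2 serves [t < e], where the previous bound with error [w] gives [2 * w * t ^+ 2]. The other
   term serves [e <= t]: convexity gives the bound [t * B], and [t <= t ^+ 2 / e]. *)
exists (2 + B / (e * w)).
  by rewrite addr_ge0 // divr_ge0 // ltW // mulr_gt0.
move=> t /andP[t0 t1].
have -> : (2 + B / (e * w)) * w = 2 * w + B / e by field; rewrite !gt_eqF.
have [te|et] := ltP t e.
  have := He t; rewrite /= sub0r normrN gtr0_norm // => /(_ te t0).
  rewrite -/w -/q => H; apply: (@le_trans _ _ (2 * w * t ^+ 2)); first by lra.
  by rewrite ler_wpM2r ?sqr_ge0 // lerDl divr_ge0 // ltW.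
apply: (@le_trans _ _ (B / e * t ^+ 2)); last first.
  by rewrite ler_wpM2r ?sqr_ge0 // lerDr mulr_ge0 // ltW.
have := sc (x + d) x t Cxd Cx; rewrite (ltW t0) t1 => /(_ isT).
rewrite segment_from.
have : 0 <= sigma / 2 * t * (1 - t) * enorm (x + d - x) ^+ 2.
  rewrite mulr_ge0 ?sqr_ge0 // mulr_ge0 ?subr_ge0 // ltW //.
  by rewrite mulr_gt0 // divr_gt0.
have : t * (h (x + d) - h x - q) <= t * B by rewrite ler_pM2l // ler_norm.
have : t * B <= B / e * t ^+ 2.
  have -> : B / e * t ^+ 2 = t * B * (t / e) by ring.
  by rewrite ler_peMr ?mulr_ge0 ?(ltW t0) // ler_pdivlMr // mul1r.
by rewrite -/q; lra.
Qed.

(** This is the tangent inequality at [x] for the convex function [L * h - f], rearranged. *)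
Lemma descent_lemma (L : R) C (f h : 'rV[R]_n -> R) x y :
  convex_function C (fun z => L * h z - f z) -> C x -> C y ->
  differentiable h x -> differentiable f x ->
  f y <= f x + dot (grad f x) (y - x)
         + L * (h y - h x - dot (grad h x) (y - x)).
Proof.
move=> cv Cx Cy dh df.
have dk : differentiable (L *: h - f) x.
  by apply: differentiableB => //; exact: differentiableZ.
have := strongly_convex_on_tangent (convex_strongly_convex_on0 cv) Cx Cy dk.
have -> : grad (L *: h - f) x = L *: grad h x - grad f x.
  apply/rowP => i; rewrite !mxE deriveB ?deriveZ //.
  - exact: diff_derivable.
  - exact: derivableZ (diff_derivable dh).
  - exact: diff_derivable.
by rewrite dotBl dotZl; lra.
Qed.

End Euclidean.

(** Clears the denominator; for [beta = 0] the quotient is +oo and the product is 0, so both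
    conditions hold. *)
Lemma le_step_bound (R : realType) (alpha beta lambda L t : R) :
  alpha < 1 -> 0 <= beta -> 0 < lambda -> 0 < L ->
  (t%:E <= step_bound alpha beta lambda L)%E =
  (t <= 1) && (t * (beta * lambda * L) <= 1 - alpha).
Proof.
move=> a1 b0 l0 L0; rewrite /step_bound le_min lee_fin; congr andb.
have [->|bN0] := eqVneq beta 0.
  rewrite !mul0r mulr0 inve0 gt0_muley ?lte_fin ?subr_gt0 // leey.
  by rewrite subr_ge0 ltW.
have bpos : 0 < beta * lambda * L by rewrite !mulr_gt0 // lt0r bN0.
by rewrite inver gt_eqF // -EFinM lee_fin ler_pdivlMr.
Qed.

(** * Sufficient decrease and finite backtracking *)

Theorem lemma17 (R : realType) (n : nat) (C : set 'rV[R]_n)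
  (f g phi : 'rV[R]_n -> \bar R) (L sigma : R)
  (C_neq0 : C !=set0) (C_open : open C) (C_convex : convex_set C)
  (A : problem_assumptions C f g phi)
  (B : subproblem_interior C f g phi)
  (f_phi_smad : smooth_adaptable L C f phi)
  (sigma_gt0 : 0 < sigma)
  (phi_strongly_convex : strongly_convex_on sigma C (fine \o phi))
  (x d : 'rV[R]_n) (x_int : interior (edom phi) x) :
  exists beta : R, 0 <= beta /\
    forall alpha lambda : R, 0 < alpha < 1 -> 0 < lambda ->
      search_direction C f g phi lambda x d ->
      (forall t : R, 0 < t -> (t%:E <= step_bound alpha beta lambda L)%E ->
         sufficient_decrease f g alpha x d t) /\
      (forall eta : R, 0 < eta < 1 ->
         exists k : nat,
           sufficient_decrease f g alpha x d (eta ^+ k) /\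
           forall j : nat, (j < k)%N ->
             ~ sufficient_decrease f g alpha x d (eta ^+ j)).
Proof.
have int_phi := kgd_int_dom (pa_kernel A).
have L0 := smad_L_gt0 f_phi_smad.
have Cx : C x by rewrite -int_phi.
have f_fin y : C y -> f y = (fine (f y))%:E.
  rewrite -int_phi => /interior_subset/(pa_f_dom A) fy.
  by rewrite fineK // fin_real // (pa_f_proper A).1.
have [[phi_C1 phi_C2] f_C1] := (pa_phi_C2 A, pa_f_C1 A).
(* Outside [C], [d] is a search direction for no [lambda]: translated by [x] it would solve the
   subproblem, against Assumption (B). Any [beta] then works. *)
have [Cxd|nCxd] := pselect (C (x + d)); last first.
  exists 0; split => // alpha lambda _ l0 [cl_xd dmin]; exfalso; apply: nCxd.
  have sub := B x lambda Cx l0; apply: sub; split => // u cl_u.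
  have := dmin (u - x); rewrite /= [x + (u - x)]addrC subrK [x + d]addrC addrK.
  exact.
have [b b0 Hb] := bregman_quadratic_bound sigma_gt0 phi_strongly_convex C_open
  Cx Cxd phi_C1 (phi_C2 _ Cx).1.
(* The 2 matches the factor [(2 * lambda)^-1] of the model, and the choice precedes [alpha] and
   [lambda]. *)
exists (2 * b); split; first by rewrite mulr_ge0.
move=> alpha lambda /andP[a0 a1] l0 [_ dmin].
have step t : 0 < t -> (t%:E <= step_bound alpha (2 * b) lambda L)%E ->
    sufficient_decrease f g alpha x d t.
  move=> t0; rewrite le_step_bound ?mulr_ge0 // => /andP[t1 tb].
  have Cxt : C (x + t *: d).
    by rewrite -segment_from; apply: convex_set_segment => //; rewrite ltW.
  rewrite /sufficient_decrease (f_fin _ Cxt) (f_fin _ Cx).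
  have gNy y : (-oo < g y)%E := (pa_g_proper A).1 y.
  have [gx|gx] := eqVneq (g x) +oo%E.
    by rewrite gx /= leey.
  (* Comparison with the feasible point 0 yields the bound on the predicted decrease and forces
     [g (x + d)] to be finite. *)
  have := dmin 0; rewrite /= addr0 => /(_ (subset_closure Cx)).
  rewrite /hess_form mul0mx !dot0r mulr0 add0e adde0.
  move: (gNy x) gx; case gxE : (g x) => [a| |] // _ _.
  move: (gNy (x + d)); case gxdE : (g (x + d)) => [c| |] // _.
  rewrite -!EFinD lee_fin -/(hess_form _ x d) => opt.
  have := pa_g_convex A (x + d) x (t := t).
  rewrite (ltW t0) t1 => /(_ isT).
  rewrite segment_from gxE gxdE.
  move: (gNy (x + t *: d)); case gxtE : (g (x + t *: d)) => [e| |] // _.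
  rewrite -!EFinM -EFinD lee_fin => ge.
  (* All terms are finite now, so the dual sums reduce to real ones. *)
  rewrite -[leLHS]/((fine (f (x + t *: d)) + e)%:E).
  rewrite -[leRHS]/((fine (f x) + a
    + alpha * t * (dot (grad (fine \o f) x) d + c - a))%:E).
  rewrite lee_fin.
  have := descent_lemma (smad_convexB f_phi_smad) Cx Cxt
    (phi_C1 _ Cx).1 (f_C1 _ Cx).1.
  have -> : x + t *: d - x = t *: d by rewrite addrC addKr.
  have := Hb t; rewrite t0 t1 => /(_ isT).
  rewrite !dotZr /=.
  set p := dot (grad (fine \o f) x) d in opt *; set D := (_ - _ - _).
  set Q := hess_form _ _ _ in opt *.
  have Q0 : 0 <= Q.
    apply: le_trans (strongly_convex_on_hess d phi_strongly_convex C_open Cx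
      phi_C1 (phi_C2 _ Cx).1).
    by rewrite mulr_ge0 ?sqr_ge0 // ltW.
  move=> /(ler_wpM2l (ltW L0)) DQ descent.
  (* Optimality leaves a surplus decrease [(1 - alpha) * t * Q / (2 * lambda)]; the step bound makes
     it absorb the error [L * (b * Q * t ^+ 2)]. *)
  have : t * (p + c - a + (2 * lambda)^-1 * Q) * (1 - alpha) <= 0.
    rewrite mulr_le0_ge0 ?mulr_ge0_le0 //; lra.
  have : t * ((2 * lambda)^-1 * Q) * (t * (2 * b * lambda * L))
         <= t * ((2 * lambda)^-1 * Q) * (1 - alpha).
    by rewrite ler_wpM2l // mulr_ge0 ?mulr_ge0 ?invr_ge0 ?mulr_ge0 // ltW.
  have -> : t * ((2 * lambda)^-1 * Q) * (t * (2 * b * lambda * L))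
            = L * (b * Q * t ^+ 2) by field; rewrite gt_eqF.
  lra.
split => // eta /andP[eta0 eta1].
have K0 : 0 <= 2 * b * lambda * L by rewrite !mulr_ge0 // ltW.
have K1 : 0 < 2 * b * lambda * L + 1 by rewrite ltr_wpDl.
(* The [+ 1] keeps the denominator positive when [b = 0]. *)
have e0 : 0 < (1 - alpha) / (2 * b * lambda * L + 1).
  by rewrite divr_gt0 ?subr_gt0.
have ex_k : exists k, `[< sufficient_decrease f g alpha x d (eta ^+ k) >].
  have eta_norm : `|eta| < 1 by rewrite gtr0_norm.
  have /cvgrPdist_lt/(_ _ e0)[k _ /(_ k (leqnn k))] := cvg_expr eta_norm.
  rewrite /= sub0r normrN gtr0_norm ?exprn_gt0 // ltr_pdivlMr // => Hk.
  exists k; apply/asboolP/step; first exact: exprn_gt0.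
  rewrite le_step_bound ?mulr_ge0 // exprn_ile1 ?ltW //=.
  by have := exprn_gt0 k eta0; lra.
(* The search stops at the least successful exponent. *)
case: (ex_minnP ex_k) => m /asboolP dm min_m.
exists m; split => // j jm /asboolP /min_m.
by rewrite leqNgt jm.
Qed.
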